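(* Let $n,d\ge 1$ and let $\Delta\in\mathbb{R}^{nd\times nd}$ be a symmetric matrix with $d\times d$ blocks $\Delta_{ij}$ (so $\Delta_{ji}=\Delta_{ij}^{\top}$) and $\Delta_{ii}=0$. Let $Z\in\mathbb{R}^{nd\times d}$ with $Z^{\top}=[I_d,\dots,I_d]$ and $A=ZZ^{\top}+\Delta$, i.e. $A_{ij}=I_d+\Delta_{ij}$. For $1\le i\le n$ let $\Delta_i^{\top}=[\Delta_{i1},\dots,\Delta_{in}]\in\mathbb{R}^{d\times nd}$ be the $i$-th block row of $\Delta$, so that $\Delta_i^{\top}Z=\sum_{j=1}^n\Delta_{ij}$. Suppose that, with $\delta=4$, \[ n\ \ge\ \frac{3\delta^2 d\|\Delta\|_{\mathrm{op}}^2}{2n}+\delta\sqrt{\frac{d}{n}}\,\|\Delta\|_{\mathrm{op}}\max_{1\le i\le n}\|\Delta_i\|_{\mathrm{op}}+\max_{1\le i\le n}\|\Delta_i^{\top}Z\|_{\mathrm{op}}+\|\Delta\|_{\mathrm{op}}. \] Then the semidefinite program \[ \max_{X\in\mathbb{R}^{nd\times nd}}\ \langle A,X\rangle\quad\text{s.t.}\quad X_{ii}=I_d\ (1\le i\le n),\ X\succeq 0 \] has a unique global maximizer $\widehat X$, this maximizer has rank exactly $d$, and $\widehat X=\widehat R\widehat R^{\top}$ where $\widehat R^{\top}=[\widehat R_1^{\top},\dots,\widehat R_n^{\top}]$ with $\widehat R_i\in O(d)$ is a global maximizer of \[ \max_{R_1,\dots,R_n\in O(d)}\ \sum_{i=1}^n\sum_{j=1}^n\langle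 R_iR_j^{\top},A_{ij}\rangle ; \] that is, the solutions of the SDP relaxation and of this (least squares) problem coincide.
   Context: $O(d)=\{O\in\mathbb{R}^{d\times d}:O^{\top}O=OO^{\top}=I_d\}$; $\langle X,Y\rangle=\mathrm{Tr}(XY^{\top})$; $\|\cdot\|_{\mathrm{op}}$ is the operator (spectral) norm. The model is orthogonal group synchronization: one observes $A_{ij}=G_iG_j^{\top}+\Delta_{ij}$ with $G_i\in O(d)$; the paper works throughout in the equivalent coordinates obtained by the change of variables $R_i\leftarrow G_i^{\top}R_i$, $\Delta_{ij}\leftarrow G_i^{\top}\Delta_{ij}G_j$, in which $A_{ij}=I_d+\Delta_{ij}$ and the ground truth is $G=Z$ (all blocks $I_d$). *)

(* Defs.v *)
From HB Require Import structures.
From mathcomp Require Import all_boot all_order all_algebra.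
From mathcomp Require Import classical_sets reals.
Set Implicit Arguments. Unset Strict Implicit. Unset Printing Implicit Defensive.
Import Order.TTheory GRing.Theory Num.Theory.
Local Open Scope ring_scope.
Local Open Scope classical_set_scope.

Section Defs.
Variable R : realType.

Definition opnorm m p (M : 'M[R]_(m, p)) : R :=
  sup [set r | exists x : 'cV[R]_p,
         (x^T *m x) 0 0 = 1 /\ r = Num.sqrt (((M *m x)^T *m (M *m x)) 0 0)].

Definition frob m p (X Y : 'M[R]_(m, p)) : R := \tr (X *m Y^T).

(* Block (i,j) of size d x d of an (n d) x (n d) matrix; the index of
   entry a of block i is mxvec_index i a (value i*d + a). *)
Definition blk n d (M : 'M[R]_(n * d)) (i j : 'I_n) : 'M[R]_d :=
  \matrix_(a, b) M (mxvec_index i a) (mxvec_index j b).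

Definition rblk n d d' (M : 'M[R]_(n * d, d')) (i : 'I_n) : 'M[R]_(d, d') :=
  \matrix_(a, b) M (mxvec_index i a) b.

Definition brow n d (M : 'M[R]_(n * d)) (i : 'I_n) : 'M[R]_(d, n * d) :=
  \matrix_(a, k) M (mxvec_index i a) k.

(* Z : (n d) x d, Z^T = [I_d, ..., I_d]. *)
Definition Zmat n d : 'M[R]_(n * d, d) :=
  \matrix_(k, b) ((pair_of_mxvec_index (mxvec_indexP k)).2 == b)%:R.

Definition orthogonal d (O : 'M[R]_d) : Prop := O^T *m O = 1%:M /\ O *m O^T = 1%:M.

Definition psd m (X : 'M[R]_m) : Prop :=
  X^T = X /\ forall v : 'cV[R]_m, 0 <= (v^T *m X *m v) 0 0.

Definition sdp_feasible n d (X : 'M[R]_(n * d)) : Prop :=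
  (forall i, blk X i i = 1%:M) /\ psd X.

Definition sdp_maximizer n d (A X : 'M[R]_(n * d)) : Prop :=
  sdp_feasible X /\ forall Y, sdp_feasible Y -> frob A Y <= frob A X.

Definition ls_obj n d (A : 'M[R]_(n * d)) (Rm : 'M[R]_(n * d, d)) : R :=
  \sum_(i < n) \sum_(j < n) frob (rblk Rm i *m (rblk Rm j)^T) (blk A i j).

Definition ls_feasible n d (Rm : 'M[R]_(n * d, d)) : Prop :=
  forall i, orthogonal (rblk Rm i).

Definition ls_maximizer n d (A : 'M[R]_(n * d)) (Rm : 'M[R]_(n * d, d)) : Prop :=
  ls_feasible Rm /\ forall Rm', ls_feasible Rm' -> ls_obj A Rm' <= ls_obj A Rm.

End Defs.

(* Main.v *)
(* The semidefinite program is certified by a least squares maximizer X, which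
   exists by compactness and, after right multiplication by an orthogonal matrix,
   makes Z^T X positive semidefinite. Comparing the objective at X and at Z gives
   n |X - Z|^2 <= 2 |Delta| |X - Z| |X + Z| (Frobenius norms of X -+ Z), hence
   |X - Z| < 4 sqrt(d/n) |Delta| unless Delta = 0. Optimality in each single block
   makes L_i = sum_j A_ij X_j X_i^T symmetric positive semidefinite, and its
   smallest eigenvalue is at least n - |X - Z|^2/2 - |Delta_i^T X|. So
   S = diag(L_i) - A satisfies S X = 0 and, under the hypothesis, is positive
   definite on the orthogonal complement of the columns of X. Since
   <A, Y> = sum_i tr L_i - <S, Y> for every feasible Y, the maximizers are the
   feasible Y with <S, Y> = 0, and X X^T is the only one. *)
Require Import Defs.
From HB Require Import structures.
From mathcomp Require Import all_boot all_order all_algebra.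
From mathcomp Require Import ring lra.
From mathcomp Require Import boolp classical_sets reals.
From mathcomp Require Import topology normedtype derive.
Set Implicit Arguments. Unset Strict Implicit. Unset Printing Implicit Defensive.
Import Order.TTheory GRing.Theory Num.Theory.
Import numFieldNormedType.Exports.
Local Open Scope ring_scope.
Local Open Scope classical_set_scope.

(** * Continuity of matrix expressions and attainment of maxima under matrix equations *)

Section Compactness.
Variable R : realType.

Definition mx_continuous (T : topologicalType) m p (F : T -> 'M[R]_(m, p)) :=
  forall i j, continuous (fun x => F x i j).

Lemma mx_continuous_id m p : @mx_continuous _ m p id.
Proof. by move=> i j; exact: coord_continuous. Qed.

Lemma mx_continuous_cst (T : topologicalType) m p (C : 'M[R]_(m, p)) :
  @mx_continuous T m p (fun=> C).
Proof. by move=> i j; exact: cst_continuous. Qed.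

Lemma mx_continuous_tr (T : topologicalType) m p (F : T -> 'M[R]_(m, p)) :
  mx_continuous F -> mx_continuous (fun x => (F x)^T).
Proof.
move=> cF i j; under [X in continuous X]eq_fun do rewrite mxE.
exact: cF.
Qed.

Lemma mx_continuous_mul (T : topologicalType) m p q
    (F : T -> 'M[R]_(m, p)) (G : T -> 'M[R]_(p, q)) :
  mx_continuous F -> mx_continuous G ->
  mx_continuous (fun x => F x *m G x).
Proof.
move=> cF cG i j; under [X in continuous X]eq_fun do rewrite mxE.
apply: continuous_big => [|k _ x].
  exact: add_continuous.
by apply: continuousM; [exact: cF|exact: cG].
Qed.

Lemma continuous_mxtrace (T : topologicalType) m (F : T -> 'M[R]_m) :
  mx_continuous F -> continuous (fun x => \tr (F x)).
Proof.
move=> cF; apply: continuous_big => [|k _]; [exact: add_continuous|exact: cF].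
Qed.

Lemma vec_mx_continuous m p :
  continuous (vec_mx : 'rV[R]_(m * p) -> 'M[R]_(m, p)).
Proof.
move=> v s /nbhs_ballP[e /= e0 es].
apply/nbhs_ballP; exists e => //= w [_ vw]; apply: es; split => // i j.
by rewrite !mxE; exact: vw.
Qed.

Lemma closed_mx_eq (T : topologicalType) m p (F : T -> 'M[R]_(m, p)) C :
  mx_continuous F -> closed [set x | F x = C].
Proof.
move=> cF.
have -> : [set x | F x = C] =
    \bigcap_(k in [set: 'I_m * 'I_p]) [set x | F x k.1 k.2 = C k.1 k.2].
  apply/seteqP; split => [x Fx k _ /=|x /= h]; first by rewrite Fx.
  by apply/matrixP => i j; exact: (h (i, j)).
apply: closed_bigI => k _.
pose g x : R := F x k.1 k.2.
change (closed (g @^-1` [set y | y = C k.1 k.2])).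
by apply: preimage_closed => [x _|]; [exact: cF|exact: closed_eq].
Qed.

(** The feasible set is cut out by continuous equations, hence closed, and is bounded entrywise, so
    the extreme value theorem applies after flattening matrices to row vectors. It supplies the
    least squares maximizer, the polar factor and the minimizer of a quadratic form on the
    sphere. *)
Lemma mx_argmax m p q r (I : Type) (G : I -> 'M[R]_(m, p) -> 'M[R]_(q, r))
    (C : I -> 'M[R]_(q, r)) (b : R) (f : 'M[R]_(m, p) -> R) X0 :
  (forall i, mx_continuous (G i)) -> continuous f ->
  (forall X, (forall i, G i X = C i) -> forall k l, `|X k l| <= b) ->
  (forall i, G i X0 = C i) ->
  exists X, (forall i, G i X = C i) /\
    forall Y, (forall i, G i Y = C i) -> f Y <= f X.
Proof.
move=> cG cf bd GX0.
pose A := [set v : 'rV[R]_(m * p) | forall i, G i (vec_mx v) = C i].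
have A0 : A !=set0 by exists (mxvec X0) => i; rewrite mxvecK.
have cA : compact A.
  apply: bounded_closed_compact; last first.
    have -> : A = \bigcap_(i in [set: I]) [set v | G i (vec_mx v) = C i].
      by apply/seteqP; split => [v h i _|v h i]; exact: h.
    apply: closed_bigI => i _; apply: closed_mx_eq => k l v.
    apply: (@continuous_comp _ _ _ vec_mx (fun X => G i X k l)).
      exact: vec_mx_continuous.
    exact: cG.
  (* The absolute value keeps the bound nonnegative, as needed for a norm that is a maximum starting
     from 0. *)
  exists `|b|; split => [|N bN v Av]; first exact: num_real.
  change (mx_norm v <= N); rewrite mx_normrE.
  have N0 : 0 <= N by exact: le_trans (normr_ge0 b) (ltW bN).
  apply: bigmax_le => // -[i j] _ /=.
  apply: le_trans (le_trans (ler_norm b) (ltW bN)).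
  by case/mxvec_indexP: j => k l; rewrite ord1 -(vec_mxK v) mxvecE bd.
have [|v vA vmax] := @EVT_max_rV _ _ (f \o vec_mx) _ A0 cA.
  apply: continuous_subspaceT => v.
  by apply: continuous_comp; [exact: vec_mx_continuous|exact: cf].
exists (vec_mx v); split; first by move: vA; rewrite inE.
move=> Y GY; rewrite -(mxvecK Y); apply: vmax; rewrite inE => i.
by rewrite mxvecK.
Qed.

End Compactness.

(** * Frobenius inner product, its norm, and the operator norm *)

Section Frobenius.
Variable R : realType.

Lemma frobE m p (X Y : 'M[R]_(m, p)) :
  frob X Y = \sum_i \sum_j X i j * Y i j.
Proof.
rewrite /frob /mxtrace; apply: eq_bigr => i _; rewrite mxE.
by apply: eq_bigr => j _; rewrite mxE.
Qed.

Lemma frobC m p (X Y : 'M[R]_(m, p)) : frob X Y = frob Y X.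
Proof. by rewrite /frob -mxtrace_tr trmx_mul trmxK. Qed.

Lemma frobDl m p (X Y W : 'M[R]_(m, p)) : frob (X + Y) W = frob X W + frob Y W.
Proof. by rewrite /frob mulmxDl linearD. Qed.

Lemma frobZl m p a (X W : 'M[R]_(m, p)) : frob (a *: X) W = a * frob X W.
Proof. by rewrite /frob -scalemxAl linearZ. Qed.

Lemma frobNl m p (X W : 'M[R]_(m, p)) : frob (- X) W = - frob X W.
Proof. by rewrite /frob mulNmx linearN. Qed.

Lemma frobDr m p (X Y W : 'M[R]_(m, p)) : frob W (X + Y) = frob W X + frob W Y.
Proof. by rewrite !(frobC W) frobDl. Qed.

Lemma frobZr m p a (X W : 'M[R]_(m, p)) : frob W (a *: X) = a * frob W X.
Proof. by rewrite !(frobC W) frobZl. Qed.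

Lemma frobNr m p (X W : 'M[R]_(m, p)) : frob W (- X) = - frob W X.
Proof. by rewrite !(frobC W) frobNl. Qed.

Definition frob_lin :=
  (frobDl, frobDr, frobNl, frobNr, frobZl, frobZr).

Lemma frob0l m p (X : 'M[R]_(m, p)) : frob 0 X = 0.
Proof. by rewrite /frob mul0mx mxtrace0. Qed.

Lemma frob_suml m p (I : Type) (s : seq I) (F : I -> 'M[R]_(m, p)) W :
  frob (\sum_(i <- s) F i) W = \sum_(i <- s) frob (F i) W.
Proof. by rewrite /frob mulmx_suml linear_sum. Qed.

Lemma frob_sumr m p (I : Type) (s : seq I) (F : I -> 'M[R]_(m, p)) W :
  frob W (\sum_(i <- s) F i) = \sum_(i <- s) frob W (F i).
Proof. by rewrite frobC frob_suml; apply: eq_bigr => i _; rewrite frobC. Qed.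

Lemma frob_trmx m p (X Y : 'M[R]_(m, p)) : frob X^T Y^T = frob X Y.
Proof. by rewrite /frob trmxK mxtrace_mulC -mxtrace_tr trmx_mul trmxK. Qed.

Lemma frob_mull m p q (A : 'M[R]_(m, p)) (X : 'M[R]_(p, q)) (Y : 'M[R]_(m, q)) :
  frob (A *m X) Y = frob X (A^T *m Y).
Proof. by rewrite /frob trmx_mul trmxK -mulmxA mxtrace_mulC mulmxA. Qed.

Lemma frob_mulr m p q (X : 'M[R]_(m, p)) (B : 'M[R]_(p, q)) (Y : 'M[R]_(m, q)) :
  frob (X *m B) Y = frob X (Y *m B^T).
Proof. by rewrite /frob trmx_mul trmxK mulmxA. Qed.

Lemma frob_ge0 m p (X : 'M[R]_(m, p)) : 0 <= frob X X.
Proof.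
rewrite frobE; apply: sumr_ge0 => i _; apply: sumr_ge0 => j _.
by rewrite -expr2 sqr_ge0.
Qed.

Lemma frob_eq0 m p (X : 'M[R]_(m, p)) : frob X X = 0 -> X = 0.
Proof.
have X20 i j : 0 <= X i j * X i j by rewrite -expr2 sqr_ge0.
rewrite frobE => /eqP; rewrite psumr_eq0 => [/allP X0|i _]; last first.
  by apply: sumr_ge0 => j _.
apply/matrixP => i j; rewrite mxE.
have := X0 i (mem_index_enum _); rewrite psumr_eq0 // => /allP/(_ j).
by rewrite mem_index_enum => /(_ isT); rewrite mulf_eq0 orbb => /eqP.
Qed.

(** The squared norm of |Y|^2 X - <X, Y> Y is |Y|^2 (|X|^2 |Y|^2 - <X, Y>^2); its nonnegativity
    gives the bound when Y is nonzero. *)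
Lemma frob_CS m p (X Y : 'M[R]_(m, p)) :
  frob X Y ^+ 2 <= frob X X * frob Y Y.
Proof.
have := frob_ge0 (frob Y Y *: X - frob X Y *: Y).
rewrite !frob_lin (frobC Y X).
have := frob_ge0 Y; rewrite le_eqVlt => /predU1P[/esym Y0 _|Ypos].
  by rewrite Y0 (frob_eq0 Y0) frobC frob0l mulr0 expr0n.
have := frob_ge0 X.
set a := frob X X; set b := frob Y Y; set c := frob X Y; rewrite -/b in Ypos.
move=> _ h; rewrite -subr_ge0 -(pmulr_rge0 _ Ypos).
by apply: le_trans h _; rewrite le_eqVlt; apply/orP; left; apply/eqP; ring.
Qed.

Definition nrm m p (X : 'M[R]_(m, p)) : R := Num.sqrt (frob X X).

Lemma nrm_ge0 m p (X : 'M[R]_(m, p)) : 0 <= nrm X.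
Proof. exact: sqrtr_ge0. Qed.

Lemma nrm_sqr m p (X : 'M[R]_(m, p)) : nrm X ^+ 2 = frob X X.
Proof. by rewrite sqr_sqrtr // frob_ge0. Qed.

Lemma nrm_le m p q r (X : 'M[R]_(m, p)) (Y : 'M[R]_(q, r)) c :
  0 <= c -> frob X X <= c ^+ 2 * frob Y Y -> nrm X <= c * nrm Y.
Proof.
move=> c0 h; rewrite -(@ler_pXn2r _ 2) ?nnegrE ?nrm_ge0 ?mulr_ge0 ?nrm_ge0 //.
by rewrite exprMn !nrm_sqr.
Qed.

Lemma frob_le_nrm m p (X Y : 'M[R]_(m, p)) : frob X Y <= nrm X * nrm Y.
Proof.
apply: le_trans (ler_norm _) _.
rewrite -(@ler_pXn2r _ 2) ?nnegrE ?normr_ge0 ?mulr_ge0 ?nrm_ge0 //.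
by rewrite real_normK ?num_real // exprMn !nrm_sqr frob_CS.
Qed.

Lemma nrmN m p (X : 'M[R]_(m, p)) : nrm (- X) = nrm X.
Proof. by rewrite /nrm frobNl frobNr opprK. Qed.

Lemma nrmD m p (X Y : 'M[R]_(m, p)) : nrm (X + Y) <= nrm X + nrm Y.
Proof.
rewrite -(@ler_pXn2r _ 2) ?nnegrE ?addr_ge0 ?nrm_ge0 //.
rewrite nrm_sqr !frob_lin (frobC Y X) sqrrD !nrm_sqr.
by have := frob_le_nrm X Y; lra.
Qed.

Lemma frob_col m p (X : 'M[R]_(m, p)) :
  frob X X = \sum_j frob (col j X) (col j X).
Proof.
rewrite frobE exchange_big; apply: eq_bigr => j _; rewrite frobE.
by apply: eq_bigr => i _; rewrite big_ord1 !mxE.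
Qed.

Lemma frob_mul_le m p q c (M : 'M[R]_(m, p)) (X : 'M[R]_(p, q)) :
  (forall v : 'cV[R]_p, frob (M *m v) (M *m v) <= c * frob v v) ->
  frob (M *m X) (M *m X) <= c * frob X X.
Proof.
move=> h; rewrite frob_col (frob_col X) mulr_sumr; apply: ler_sum => j _.
by rewrite !colE -mulmxA.
Qed.

Lemma nrm_mulmx m p q (M : 'M[R]_(m, p)) (X : 'M[R]_(p, q)) :
  nrm (M *m X) <= nrm M * nrm X.
Proof.
apply: nrm_le; first exact: nrm_ge0.
rewrite nrm_sqr; apply: frob_mul_le => v.
rewrite frobE [in leRHS]frobE mulr_suml; apply: ler_sum => i _; rewrite big_ord1.
have := frob_CS (row i M) v^T.
rewrite frob_trmx frobE big_ord1 [frob (row i M) _]frobE big_ord1 => h.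
have -> : (M *m v) i 0 * (M *m v) i 0 =
   (\sum_j row i M 0 j * v^T 0 j) ^+ 2.
  by rewrite expr2 mxE; congr (_ * _); apply: eq_bigr => j _; rewrite !mxE.
apply: le_trans h _; apply: ler_wpM2r; first exact: frob_ge0.
by apply: ler_sum => j _; rewrite !mxE.
Qed.

Lemma nrm_tr m p (X : 'M[R]_(m, p)) : nrm X^T = nrm X.
Proof. by rewrite /nrm frob_trmx. Qed.

Lemma frob_cVE m (v w : 'cV[R]_m) : (v^T *m w) 0 0 = frob v w.
Proof. by rewrite frobC frobE mxE; apply: eq_bigr => i _; rewrite big_ord1 mxE mulrC. Qed.

Lemma frob_delta m (x : 'cV[R]_m) i : frob x (delta_mx i 0) = x i 0.
Proof.
rewrite frobE (bigD1 i) //= big_ord1 mxE !eqxx mulr1 big1 ?addr0 // => k ki.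
by rewrite big_ord1 mxE (negPf ki) mulr0.
Qed.

Lemma opnorm_le m p (M : 'M[R]_(m, p)) (v : 'cV[R]_p) :
  nrm (M *m v) <= opnorm M * nrm v.
Proof.
have [v0|vN0] := eqVneq (nrm v) 0.
  have -> : v = 0 by apply: frob_eq0; rewrite -nrm_sqr v0 expr0n.
  by rewrite mulmx0 /nrm !frob0l sqrtr0 mulr0.
have vpos : 0 < nrm v by rewrite lt_def vN0 nrm_ge0.
rewrite -ler_pdivrMr //.
(* The Frobenius norm of [M] bounds the values on unit vectors, so the supremum is a genuine upper
   bound. *)
apply: ub_le_sup.
  exists (nrm M) => r [x [x1 ->]].
  rewrite frob_cVE -/(nrm _); apply: le_trans (nrm_mulmx _ _) _.
  by rewrite /nrm -(frob_cVE x) x1 sqrtr1 mulr1.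
exists ((nrm v)^-1 *: v); rewrite !frob_cVE -scalemxAr !frob_lin -nrm_sqr.
split; first by rewrite expr2; field.
rewrite mulrA -expr2 sqrtrM ?sqr_ge0 // sqrtr_sqr ger0_norm ?invr_ge0 ?nrm_ge0 //.
by rewrite mulrC.
Qed.

Lemma opnorm_ge0 m p (M : 'M[R]_(m, p)) : 0 <= opnorm M.
Proof.
have [[r h]|/asboolP hN] := pselect ([set r | exists x : 'cV[R]_p, (x^T *m x) 0 0 = 1 /\
    r = Num.sqrt (((M *m x)^T *m (M *m x)) 0 0)] !=set0).
  case: (h) => x [x1 _]; have := opnorm_le M x.
  rewrite /nrm -(frob_cVE x) x1 sqrtr1 mulr1; apply: le_trans; exact: sqrtr_ge0.
(* Without unit vectors, that is for [p = 0], the supremum is 0 by convention. *)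
rewrite /opnorm sup_out // => -[] h _; move: hN; rewrite asboolE; exact.
Qed.

Lemma nrm_opnorm m p q (M : 'M[R]_(m, p)) (X : 'M[R]_(p, q)) :
  nrm (M *m X) <= opnorm M * nrm X.
Proof.
apply: nrm_le; first exact: opnorm_ge0.
apply: frob_mul_le => v; have h := opnorm_le M v.
rewrite -!nrm_sqr -exprMn lerXn2r ?nnegrE ?nrm_ge0 ?mulr_ge0 ?opnorm_ge0 ?nrm_ge0 //.
Qed.

(** From |MX|^2 = <X, M^T M X> <= |X| |M^T| |MX|, divided by |MX|. The transposed form suits the
    tall matrices Delta_i, whose operator norms occur in the theorem. *)
Lemma nrm_opnorm_tr m p q (M : 'M[R]_(m, p)) (X : 'M[R]_(p, q)) :
  nrm (M *m X) <= opnorm M^T * nrm X.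
Proof.
have [->|MX0] := eqVneq (nrm (M *m X)) 0.
  by rewrite mulr_ge0 ?opnorm_ge0 ?nrm_ge0.
have MXpos : 0 < nrm (M *m X) by rewrite lt_def MX0 nrm_ge0.
rewrite -(ler_pM2l MXpos) -expr2 nrm_sqr frob_mull.
apply: le_trans (frob_le_nrm _ _) _.
have := nrm_opnorm M^T (M *m X); have := nrm_ge0 X; nra.
Qed.

End Frobenius.

(** * Positive semidefinite forms, rank one decompositions, and a trace criterion for positivity *)

Section PositiveSemidefinite.
Variable R : realType.

Lemma psdP m (X : 'M[R]_m) :
  psd X <-> X^T = X /\ forall v : 'cV[R]_m, 0 <= frob (X *m v) v.
Proof.
have E (v : 'cV[R]_m) : (v^T *m X *m v) 0 0 = frob (X *m v) v.
  by rewrite -mulmxA frob_cVE frobC.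
by split=> -[hs hX]; split=> // v; [rewrite -E|rewrite E].
Qed.

Lemma quad_ge0_lin_eq0 (a q : R) :
  (forall t, 0 <= 2 * t * a + t ^+ 2 * q) -> a = 0.
Proof.
move=> h; have k0 : 0 < `|q| + 1 by have := normr_ge0 q; lra.
(* At this [t] the linear term outweighs the quadratic one, whatever the sign of [q], unless
   [a = 0]. *)
have := h (- (a / (`|q| + 1))).
set s := a / _; have sE : a = s * (`|q| + 1) by rewrite /s; field; lra.
rewrite {1}sE sqrrN => h1.
have s0 : s ^+ 2 * (`|q| + 1) <= 0.
  have : s ^+ 2 * q <= s ^+ 2 * `|q| by rewrite ler_wpM2l ?sqr_ge0 ?ler_norm.
  by have := sqr_ge0 s; nra.
have : s ^+ 2 <= 0 by rewrite -(pmulr_lle0 _ k0).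
rewrite le_eqVlt ltNge sqr_ge0 orbF sqrf_eq0 => /eqP s00.
by rewrite sE s00 mul0r.
Qed.

Lemma frob_sym m (X : 'M[R]_m) (v w : 'cV[R]_m) :
  X^T = X -> frob (X *m v) w = frob (X *m w) v.
Proof. by move=> sX; rewrite frob_mull sX frobC. Qed.

(** Along v + t X v the form is 2 t |X v|^2 plus a multiple of t^2, so nonnegativity for all t kills
    |X v|^2. *)
Lemma psd_form_eq0 m (X : 'M[R]_m) (v : 'cV[R]_m) :
  psd X -> frob (X *m v) v = 0 -> X *m v = 0.
Proof.
move=> /psdP[sX pX] v0; apply: frob_eq0.
apply: (@quad_ge0_lin_eq0 _ (frob (X *m (X *m v)) (X *m v))) => t.
have := pX (v + t *: (X *m v)).
rewrite mulmxDr -scalemxAr !frob_lin v0 (frob_sym _ v sX) => h.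
by apply: le_trans h _; rewrite le_eqVlt; apply/orP; left; apply/eqP; ring.
Qed.

Lemma frob_outer m (y v : 'cV[R]_m) : frob (y *m y^T *m v) v = frob y v ^+ 2.
Proof. by rewrite -mulmxA frob_mull frobE !big_ord1 frob_cVE -expr2. Qed.

(** With c = <X e, e>, the deflated form at v is the form of X at v - (<X e, v> / c) e. *)
Lemma psd_deflate m (X : 'M[R]_m) (e : 'cV[R]_m) :
  psd X -> 0 < frob (X *m e) e ->
  psd (X - (frob (X *m e) e)^-1 *: ((X *m e) *m (X *m e)^T)).
Proof.
move=> /psdP[sX pX]; set c := frob _ _ => c0; apply/psdP; split.
  by rewrite linearB linearZ /= [(X *m e *m _)^T]trmx_mul trmxK sX.
move=> v; rewrite mulmxBl -scalemxAl frobDl frobNl frobZl frob_outer.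
have := pX (v - (frob (X *m e) v / c) *: e).
rewrite mulmxBr -scalemxAr !frob_lin -/c (frob_sym v e sX).
set b := frob (X *m e) v => h.
apply: le_trans h _; rewrite le_eqVlt; apply/orP; left; apply/eqP; field.
by rewrite gt_eqF.
Qed.

(** Cholesky elimination: deflating along a basis vector puts it in the kernel and, by symmetry,
    keeps what was there. A zero pivot is already in the kernel by [psd_form_eq0]. *)
Lemma psd_deflate_seq m (r : seq 'I_m) (X : 'M[R]_m) : psd X ->
  exists (s : seq 'cV[R]_m) (Y : 'M[R]_m),
    [/\ psd Y, X = \sum_(v <- s) v *m v^T + Y,
        forall v : 'cV[R]_m, X *m v = 0 -> Y *m v = 0 &
        forall i, i \in r -> Y *m (delta_mx i 0 : 'cV[R]_m) = 0].
Proof.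
move=> pX; elim: r => [|i r [s [Y [pY XE kY rY]]]].
  by exists [::], X; rewrite big_nil add0r.
set e : 'cV[R]_m := delta_mx i 0.
case/psdP: (pY) => sY /(_ e); rewrite le_eqVlt => /predU1P[/esym e0|epos].
  exists s, Y; split => // j; rewrite inE => /predU1P[->|]; last exact: rY.
  exact: psd_form_eq0.
set c := frob _ _ in epos.
have kerS v : Y *m v = 0 -> (Y - c^-1 *: (Y *m e *m (Y *m e)^T)) *m v = 0.
  move=> Yv; rewrite mulmxBl Yv -scalemxAl -(mulmxA (Y *m e)) trmx_mul sY.
  by rewrite -(mulmxA e^T) Yv !mulmx0 scaler0 subr0.
exists (Num.sqrt c^-1 *: (Y *m e) :: s), (Y - c^-1 *: (Y *m e *m (Y *m e)^T)).
split; [exact: psd_deflate| | by move=> v /kY/kerS |].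
  rewrite big_cons linearZ /= -scalemxAl -scalemxAr scalerA -expr2 sqr_sqrtr.
    by rewrite XE [_ *: _ + _]addrC -addrA [_ *: _ + (Y - _)]addrC subrK.
  by rewrite invr_ge0 ltW.
move=> j; rewrite inE => /predU1P[->|/rY/kerS //].
rewrite mulmxBl -scalemxAl -(mulmxA (Y *m e)).
have -> : (Y *m e)^T *m e = c%:M.
  by apply/matrixP => a b; rewrite !ord1 frob_cVE mxE eqxx.
by rewrite mul_mx_scalar scalerA mulVf ?gt_eqF // scale1r subrr.
Qed.

(** Once all basis vectors are eliminated the remainder is 0. This turns <S, Y>, for Y positive
    semidefinite, into a sum of values of the form of S, with no spectral theorem. *)
Lemma psd_sum_outer m (X : 'M[R]_m) : psd X ->
  exists s : seq 'cV[R]_m, X = \sum_(v <- s) v *m v^T.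
Proof.
move=> /(psd_deflate_seq (enum 'I_m))[s [Y [_ XE _ Y0]]]; exists s.
suff Y00 : Y = 0 by rewrite {1}XE Y00 addr0.
apply/matrixP => a b; have := Y0 b (mem_enum _ b).
by rewrite -colE => /matrixP/(_ a 0); rewrite !mxE.
Qed.

Lemma frob_sum_outer m (S : 'M[R]_m) (s : seq 'cV[R]_m) :
  frob S (\sum_(v <- s) v *m v^T) = \sum_(v <- s) frob (S *m v) v.
Proof.
by rewrite frob_sumr; apply: eq_bigr => v _; rewrite frob_mulr.
Qed.

(* The minimum of the quadratic form on the unit sphere is attained at an
   eigenvector, where the two sides of the conclusion can be compared. *)
Lemma psd_form_lower m (M : 'M[R]_m) c : psd M ->
  (forall v : 'cV[R]_m, c * nrm v <= nrm (M *m v)) ->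
  forall v : 'cV[R]_m, c * frob v v <= frob (M *m v) v.
Proof.
move=> /psdP[sM pM] hc v.
have [->|vN0] := eqVneq v 0; first by rewrite mulmx0 !frob0l mulr0.
have sphereP (x : 'cV[R]_m) : x^T *m x = 1%:M <-> frob x x = 1.
  rewrite -frob_cVE; split=> [->|h]; first by rewrite mxE eqxx.
  by apply/matrixP => i j; rewrite !ord1 h mxE eqxx.
have frob_gt0 (x : 'cV[R]_m) : x != 0 -> 0 < frob x x.
  move=> x0; rewrite lt_def frob_ge0 andbT; apply: contra_neq x0; exact: frob_eq0.
have normalize (x : 'cV[R]_m) : x != 0 ->
    ((nrm x)^-1 *: x)^T *m ((nrm x)^-1 *: x) = 1%:M.
  move=> /frob_gt0 x0; apply/sphereP; rewrite !frob_lin -nrm_sqr; field.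
  by rewrite gt_eqF // sqrtr_gt0.
have [|||_|x [xS xmax]] := @mx_argmax R m 1 1 1 unit
  (fun _ x => x^T *m x) (fun=> 1%:M) 1 (fun x => \tr ((- M *m x) *m x^T))
  ((nrm v)^-1 *: v).
- move=> _; apply: mx_continuous_mul; last exact: mx_continuous_id.
  by apply: mx_continuous_tr; exact: mx_continuous_id.
- apply: continuous_mxtrace; apply: mx_continuous_mul; last first.
    by apply: mx_continuous_tr; exact: mx_continuous_id.
  apply: mx_continuous_mul; [exact: mx_continuous_cst|exact: mx_continuous_id].
- move=> x /(_ tt)/sphereP x1 k l; rewrite ord1 -(@ler_pXn2r _ 2) ?nnegrE //.
  rewrite real_normK ?num_real // expr1n -x1 frobE (bigD1 k) //= big_ord1 -expr2.
  by rewrite lerDl sumr_ge0 // => i _; rewrite big_ord1 -expr2 sqr_ge0.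
- exact: normalize.
have x1 : frob x x = 1 by apply/sphereP; exact: xS tt.
set mu := frob (M *m x) x.
have hmin (y : 'cV[R]_m) : mu * frob y y <= frob (M *m y) y.
  have [->|yN0] := eqVneq y 0; first by rewrite mulmx0 !frob0l mulr0.
  have := xmax _ (fun _ => normalize y yN0).
  rewrite -!/(frob _ _) !mulNmx !frobNl lerN2 -scalemxAr !frob_lin -/mu mulrA.
  rewrite -expr2 exprVn nrm_sqr mulrC.
  by rewrite ler_pdivlMr // frob_gt0.
(* The form of M - mu I is nonnegative and vanishes at [x], so [x] is in its kernel: this is the
   eigenvector equation. *)
have pN : psd (M - mu%:M).
  apply/psdP; split; first by rewrite linearB /= sM tr_scalar_mx.
  by move=> y; rewrite mulmxBl mul_scalar_mx !frob_lin subr_ge0.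
have Mx : M *m x = mu *: x.
  apply/eqP; rewrite -subr_eq0 -mul_scalar_mx -mulmxBl; apply/eqP.
  apply: psd_form_eq0 pN _.
  by rewrite mulmxBl mul_scalar_mx !frob_lin x1 mulr1 subrr.
have cmu : c <= mu.
  have := hc x; rewrite Mx /nrm !frob_lin x1 sqrtr1 !mulr1 -expr2 sqrtr_sqr.
  by rewrite ger0_norm //; exact: pM.
by apply: le_trans (hmin v); rewrite ler_wpM2r ?frob_ge0.
Qed.

Lemma outer_mul m (u v : 'cV[R]_m) :
  (u *m u^T) *m (v *m v^T) = frob u v *: (u *m v^T).
Proof.
rewrite mulmxA -(mulmxA u) -frob_cVE.
have -> : u^T *m v = ((u^T *m v) 0 0)%:M.
  by apply/matrixP => i j; rewrite !ord1 [RHS]mxE eqxx.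
by rewrite mul_mx_scalar -scalemxAl [in RHS]mxE eqxx mulr1n.
Qed.

Definition householder m (v : 'cV[R]_m) : 'M[R]_m :=
  1%:M - (2 / frob v v) *: (v *m v^T).

Lemma householder_tr m (v : 'cV[R]_m) : (householder v)^T = householder v.
Proof. by rewrite linearB linearZ /= trmx1 trmx_mul trmxK. Qed.

Lemma householder_sqr m (v : 'cV[R]_m) :
  frob v v != 0 -> householder v *m householder v = 1%:M.
Proof.
move=> v0; rewrite /householder mulmxBl mul1mx mulmxBr mulmx1.
rewrite -scalemxAl -scalemxAr outer_mul !scalerA.
apply/matrixP => i j; rewrite !mxE; field; exact: v0.
Qed.

Lemma orthogonal_householder m (v : 'cV[R]_m) :
  frob v v != 0 -> Defs.orthogonal (householder v).
Proof. by move=> v0; rewrite /Defs.orthogonal householder_tr householder_sqr. Qed.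

Lemma orthogonal_mul m (P Q : 'M[R]_m) :
  Defs.orthogonal P -> Defs.orthogonal Q -> Defs.orthogonal (P *m Q).
Proof.
move=> [P1 P2] [Q1 Q2]; rewrite /Defs.orthogonal trmx_mul; split.
  by rewrite mulmxA -(mulmxA Q^T) P1 mulmx1.
by rewrite mulmxA -(mulmxA P) Q2 mulmx1.
Qed.

Lemma mxtrace_outer_mul m (M : 'M[R]_m) (u v : 'cV[R]_m) :
  \tr (u *m v^T *m M) = frob (M *m u) v.
Proof. by rewrite frob_mull /frob trmx_mul trmxK mulmxA. Qed.

(* Reflections give positivity; products of the reflections along e_a and
   e_a + t e_b (rotations of angle O(t)) give symmetry to first order in t. *)
Lemma orthogonal_max_psd m (M : 'M[R]_m) :
  (forall Q, Defs.orthogonal Q -> \tr (Q *m M) <= \tr M) -> psd M.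
Proof.
move=> hM; apply/psdP; split; last first.
  move=> v; have [v0|v0] := eqVneq (frob v v) 0.
    by rewrite (frob_eq0 v0) frobC frob0l.
  have vpos : 0 < frob v v by rewrite lt_def v0 frob_ge0.
  have := hM _ (orthogonal_householder v0).
  rewrite mulmxBl mul1mx linearB /= -scalemxAl linearZ /= mxtrace_outer_mul.
  by rewrite gerBl pmulr_rge0 // divr_gt0.
apply/matrixP => a b; rewrite mxE.
have [->//|ab] := eqVneq a b.
pose u : 'cV[R]_m := delta_mx a 0; pose w : 'cV[R]_m := delta_mx b 0.
have Mij i j : frob (M *m delta_mx j 0) (delta_mx i 0 : 'cV[R]_m) = M i j.
  by rewrite frob_delta -colE mxE.
apply/esym/eqP; rewrite -subr_eq0; apply/eqP.
(* Multiplied by 1 + t^2, the trace inequality for the two reflections becomes 0 <= 2 t (M_ab -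
   M_ba) + 2 t^2 (M_aa + M_bb). *)
apply: (@quad_ge0_lin_eq0 _ (2 * (M a a + M b b))) => t.
pose v := u + t *: w.
have uu : frob u u = 1 by rewrite frob_delta mxE !eqxx.
have ww : frob w w = 1 by rewrite frob_delta mxE !eqxx.
have uw : frob u w = 0 by rewrite frob_delta mxE eq_sym (negPf ab).
have uv : frob u v = 1 by rewrite frobDr frobZr uu uw mulr0 addr0.
have vv : frob v v = 1 + t ^+ 2.
  by rewrite /v !frob_lin (frobC w u) uu ww uw; ring.
have vpos : 0 < frob v v by rewrite vv; have := sqr_ge0 t; lra.
have u0 : frob u u != 0 by rewrite uu oner_eq0.
have v0 : frob v v != 0 by rewrite gt_eqF.
have := hM _ (orthogonal_mul (orthogonal_householder u0) (orthogonal_householder v0)).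
rewrite /householder mulmxBl mul1mx mulmxBr mulmx1 -scalemxAl -scalemxAr outer_mul.
rewrite uu uv scale1r; set k := frob v v in vv vpos v0 *.
rewrite !mulmxBl mul1mx -!scalemxAl.
rewrite !linearB /= !mxtraceZ.
rewrite !mxtrace_outer_mul /v mulmxDr -!scalemxAr !frob_lin !Mij => h.
have {}h : 0 <= k * (2 / k * (M a a + t * M a b + t * (M b a + t * M b b))
   + 2 * (M a a - 2 / k * (M a a + t * M b a))).
  by rewrite pmulr_rge0 //; lra.
apply: le_trans h _; rewrite le_eqVlt; apply/orP; left; apply/eqP.
by rewrite vv in v0 *; field.
Qed.

End PositiveSemidefinite.

(** * Block structure, feasible points, and existence of a least squares maximizer *)

Section Blocks.
Variables (R : realType) (n d : nat).

(* The embedding of R^d as block i of R^(nd); blocks are then matrix products. *)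
Definition blkinj (i : 'I_n) : 'M[R]_(n * d, d) :=
  \matrix_(k, b) (k == mxvec_index i b)%:R.

Lemma mxvec_index_inj i a j b :
  (mxvec_index i a == mxvec_index j b :> 'I_(n * d)) = (i == j) && (a == b).
Proof.
apply/eqP/andP => [h|[/eqP-> /eqP->//]].
have : (i, a) = (j, b) by apply: enum_rank_inj; exact: cast_ord_inj h.
by case=> -> ->.
Qed.

Lemma blkinj_trmul q (M : 'M[R]_(n * d, q)) i a k :
  ((blkinj i)^T *m M) a k = M (mxvec_index i a) k.
Proof.
rewrite mxE (bigD1 (mxvec_index i a)) //= !mxE eqxx mul1r big1 ?addr0 // => l li.
by rewrite !mxE (negPf li) mul0r.
Qed.

Lemma rblkE q (M : 'M[R]_(n * d, q)) i : rblk M i = (blkinj i)^T *m M.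
Proof. by apply/matrixP => a b; rewrite blkinj_trmul mxE. Qed.

Lemma browE (M : 'M[R]_(n * d)) i : brow M i = (blkinj i)^T *m M.
Proof. by apply/matrixP => a b; rewrite blkinj_trmul mxE. Qed.

Lemma blkE (M : 'M[R]_(n * d)) i j : blk M i j = (blkinj i)^T *m M *m blkinj j.
Proof.
have -> : (blkinj i)^T *m M *m blkinj j = ((blkinj j)^T *m ((blkinj i)^T *m M)^T)^T.
  by rewrite trmx_mul !trmxK.
by apply/matrixP => a b; rewrite mxE [RHS]mxE blkinj_trmul [RHS]mxE blkinj_trmul.
Qed.

Lemma blkinj_ext q (M N : 'M[R]_(n * d, q)) :
  (forall i, (blkinj i)^T *m M = (blkinj i)^T *m N) -> M = N.
Proof.
move=> h; apply/matrixP => k b; case/mxvec_indexP: k => i a.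
by rewrite -!blkinj_trmul h.
Qed.

Lemma blkinj_id i : (blkinj i)^T *m blkinj i = 1%:M.
Proof. by apply/matrixP => a b; rewrite blkinj_trmul !mxE mxvec_index_inj eqxx. Qed.

Lemma blkinj_neq i j : i != j -> (blkinj i)^T *m blkinj j = 0.
Proof.
by move=> ij; apply/matrixP => a b; rewrite blkinj_trmul !mxE mxvec_index_inj (negPf ij).
Qed.

Lemma blkinj_sum q (F : 'I_n -> 'M[R]_(d, q)) j :
  (blkinj j)^T *m (\sum_i blkinj i *m F i) = F j.
Proof.
rewrite mulmx_sumr (bigD1 j) //= mulmxA blkinj_id mul1mx big1 ?addr0 // => i ij.
by rewrite mulmxA blkinj_neq ?mul0mx // eq_sym.
Qed.

Lemma blkinj_resolution : \sum_i blkinj i *m (blkinj i)^T = 1%:M.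
Proof. by apply: blkinj_ext => j; rewrite blkinj_sum mulmx1. Qed.

Lemma blkinj_Z i : (blkinj i)^T *m Zmat R n d = 1%:M.
Proof.
(* [Zmat] reads the inner index off a witness of [is_mxvec_index]; whatever the witness, its pair
   encodes [k]. *)
have pairK (k : 'I_(n * d)) (h : is_mxvec_index k) :
  k = mxvec_index (pair_of_mxvec_index h).1 (pair_of_mxvec_index h).2 by case: h.
apply/matrixP => a b; rewrite blkinj_trmul !mxE.
have /eqP := pairK _ (mxvec_indexP (mxvec_index i a)).
by rewrite mxvec_index_inj => /andP[_ /eqP <-].
Qed.

Lemma frob_blocks q (X Y : 'M[R]_(n * d, q)) :
  frob X Y = \sum_i frob ((blkinj i)^T *m X) ((blkinj i)^T *m Y).
Proof.
rewrite -{1}[X]mul1mx -blkinj_resolution mulmx_suml frob_suml.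
by apply: eq_bigr => i _; rewrite -mulmxA frob_mull.
Qed.

(** The objective is also <A, X X^T>: the least squares problem is the semidefinite program
    restricted to Gram matrices of feasible X. *)
Lemma ls_objE (A : 'M[R]_(n * d)) (X : 'M[R]_(n * d, d)) :
  ls_obj A X = frob (A *m X) X.
Proof.
rewrite /ls_obj frob_mulr frobC frob_blocks; apply: eq_bigr => i _.
rewrite -frob_trmx frob_blocks; apply: eq_bigr => j _.
by rewrite !rblkE blkE -frob_trmx !trmx_mul !trmxK !mulmxA.
Qed.

Lemma ls_feasible_gram (X : 'M[R]_(n * d, d)) :
  ls_feasible X -> X^T *m X = n%:R%:M.
Proof.
move=> fX; rewrite -{2}[X]mul1mx -blkinj_resolution mulmx_suml mulmx_sumr.
rewrite (eq_bigr (fun=> 1%:M)) => [|i _]; last first.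
  by have [] := fX i; rewrite rblkE trmx_mul trmxK !mulmxA.
by rewrite sumr_const card_ord -scaler_nat scale_scalar_mx mulr1.
Qed.

Lemma ls_feasible_frob (X : 'M[R]_(n * d, d)) :
  ls_feasible X -> frob X X = (n * d)%:R.
Proof.
move=> fX; rewrite -frob_trmx /frob trmxK ls_feasible_gram // mxtrace_scalar.
by rewrite natrM mulr_natr.
Qed.

Lemma ls_feasible_Z : ls_feasible (Zmat R n d).
Proof. by move=> i; rewrite rblkE blkinj_Z /Defs.orthogonal trmx1 mulmx1. Qed.

Lemma sdp_feasible_gram (X : 'M[R]_(n * d, d)) :
  ls_feasible X -> sdp_feasible (X *m X^T).
Proof.
move=> fX; split => [i|].
  have [_] := fX i; rewrite rblkE blkE => <-.
  by rewrite trmx_mul trmxK !mulmxA.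
apply/psdP; split; first by rewrite trmx_mul trmxK.
by move=> v; rewrite -mulmxA frob_mull frob_ge0.
Qed.

Lemma orthonormal_cols_le1 p q (O : 'M[R]_(p, q)) :
  O^T *m O = 1%:M -> forall a b, `|O a b| <= 1.
Proof.
move=> /matrixP h a b; rewrite -(@ler_pXn2r _ 2) ?nnegrE //.
rewrite real_normK ?num_real // expr1n.
have := h b b; rewrite !mxE eqxx (bigD1 a) //= mxE -expr2 mulr1n => <-.
by rewrite lerDl sumr_ge0 // => i _; rewrite mxE -expr2 sqr_ge0.
Qed.

Lemma exists_ls_maximizer (A : 'M[R]_(n * d)) : exists X, ls_maximizer A X.
Proof.
(* Only X_i^T X_i = I is imposed; the blocks being square, the other orthogonality relation
   follows. *)
have [||X hX k l|i|X [XS Xmax]] := @mx_argmax R (n * d) d d d 'I_n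
  (fun i X => (rblk X i)^T *m rblk X i) (fun=> 1%:M) 1
  (fun X => \tr (A *m X *m X^T)) (Zmat R n d).
- move=> i k l; under [X in continuous X]eq_fun do rewrite rblkE.
  move: k l; apply: mx_continuous_mul; [apply: mx_continuous_tr|];
    by apply: mx_continuous_mul; [exact: mx_continuous_cst|exact: mx_continuous_id].
- apply: continuous_mxtrace; apply: mx_continuous_mul.
    by apply: mx_continuous_mul; [exact: mx_continuous_cst|exact: mx_continuous_id].
  by apply: mx_continuous_tr; exact: mx_continuous_id.
- case/mxvec_indexP: k => i a; have := orthonormal_cols_le1 (hX i) a l.
  by rewrite mxE.
- by have [] := ls_feasible_Z i.
exists X; split => [i|Y fY]; first by split; [exact: XS|exact/mulmx1C/XS].
by rewrite !ls_objE; apply: Xmax => i; have [] := fY i.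
Qed.

End Blocks.

(** A maximizer Q of tr(M Q) over orthogonal matrices satisfies tr(O M Q) <= tr(M Q) for every
    orthogonal O, which is the criterion of [orthogonal_max_psd]. *)
Lemma exists_polar (R : realType) m (M : 'M[R]_m) :
  exists2 Q, Defs.orthogonal Q & psd (M *m Q).
Proof.
have [||X hX k l|i|Q [QS Qmax]] := @mx_argmax R m m m m unit
  (fun _ X => X^T *m X) (fun=> 1%:M) 1 (fun X => \tr (M *m X)) 1%:M.
- move=> _; apply: mx_continuous_mul; last exact: mx_continuous_id.
  by apply: mx_continuous_tr; exact: mx_continuous_id.
- apply: continuous_mxtrace.
  by apply: mx_continuous_mul; [exact: mx_continuous_cst|exact: mx_continuous_id].
- exact: orthonormal_cols_le1 (hX tt) k l.
- by rewrite trmx1 mulmx1.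
have oQ : Defs.orthogonal Q by split; [exact: QS tt|exact/mulmx1C/(QS tt)].
exists Q => //; apply: orthogonal_max_psd => O oO.
rewrite mxtrace_mulC -mulmxA; apply: Qmax => _.
by have [] := orthogonal_mul oQ oO.
Qed.

(** * Distance from the maximizer to Z, and the dual certificate *)

Section Certificate.
Variables (R : realType) (n d : nat) (Delta : 'M[R]_(n * d)) (X : 'M[R]_(n * d, d)).
Hypotheses (hsym : Delta^T = Delta) (hdiag : forall i, blk Delta i i = 0).
Notation Z := (Zmat R n d).
Notation E := (@blkinj R n d).
Let A := Z *m Z^T + Delta.
Hypothesis fX : ls_feasible X.
Hypothesis optX : forall Y, ls_feasible Y -> frob (A *m Y) Y <= frob (A *m X) X.
Hypothesis pP : psd (Z^T *m X).

Let dist := nrm (X - Z).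

Lemma A_sym : A^T = A.
Proof. by rewrite /A linearD /= trmx_mul trmxK hsym. Qed.

Lemma A_diag i : (E i)^T *m A *m E i = 1%:M.
Proof.
rewrite mulmxDr mulmxDl -(blkE Delta) hdiag addr0 mulmxA blkinj_Z mul1mx.
by rewrite -[E i]trmxK -trmx_mul blkinj_Z trmx1.
Qed.

Lemma X_blkl i : (rblk X i)^T *m rblk X i = 1%:M. Proof. by have [] := fX i. Qed.
Lemma X_blkr i : rblk X i *m (rblk X i)^T = 1%:M. Proof. by have [] := fX i. Qed.

(** The dual variable L_i of the constraint X_ii = I_d, the sum over j of A_ij X_j X_i^T. *)
Definition multiplier i : 'M[R]_d := (E i)^T *m A *m X *m (rblk X i)^T.

(* Only block i is varied: X_i is replaced by Q^T X_i. *)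
Lemma multiplier_psd i : psd (multiplier i - 1%:M).
Proof.
apply: orthogonal_max_psd => Q [Q1 Q2].
pose W := (Q^T - 1%:M) *m rblk X i.
have fY : ls_feasible (X + E i *m W).
  move=> j; rewrite rblkE mulmxDr mulmxA.
  have [->|ij] := eqVneq j i.
    rewrite blkinj_id mul1mx -rblkE /W mulmxBl mul1mx addrC subrK.
    rewrite /Defs.orthogonal trmx_mul trmxK; split.
      by rewrite mulmxA -(mulmxA _ Q) Q2 mulmx1 X_blkl.
    by rewrite mulmxA -(mulmxA Q^T) X_blkr mulmx1.
  by rewrite blkinj_neq // mul0mx addr0 -rblkE; exact: fX.
have := optX fY; rewrite mulmxDr !frob_lin.
have -> : frob (A *m (E i *m W)) X = frob (A *m X) (E i *m W).
  by rewrite frob_mull A_sym frobC.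
have -> : frob (A *m X) (E i *m W) = \tr (Q *m multiplier i) - \tr (multiplier i).
  rewrite frobC frob_mull /W frob_mulr !mulmxA -/(multiplier i).
  rewrite frobC /frob linearB /= trmxK trmx1 mulmxBr mulmx1 linearB /=.
  by rewrite mxtrace_mulC /multiplier !mulmxA.
(* As A_ii = I, the second order term is |W|^2 = 2 tr I - 2 tr Q. It is what replaces L_i by L_i - I
   in the trace criterion. *)
have -> : frob (A *m (E i *m W)) (E i *m W) = 2 * \tr (1%:M : 'M[R]_d) - 2 * \tr Q.
  rewrite frobC frob_mull !mulmxA A_diag mul1mx /W frob_mulr -mulmxA X_blkr mulmx1.
  rewrite /frob linearB /= trmxK trmx1 mulmxBr mulmx1 mulmxBl mul1mx Q1.
  by rewrite !linearB /= mxtrace_tr; ring.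
rewrite mulmxBr mulmx1 !linearB /=; lra.
Qed.

Lemma multiplier_sym i : (multiplier i)^T = multiplier i.
Proof.
by case: (multiplier_psd i) => + _; rewrite linearB /= trmx1 => /addIr.
Qed.

(** Expansion of |(X - Z) w|^2, using |X w|^2 = |Z w|^2 = n |w|^2. *)
Lemma form_deficit (w : 'cV[R]_d) :
  n%:R * frob w w - frob (Z^T *m X *m w) w = frob ((X - Z) *m w) ((X - Z) *m w) / 2.
Proof.
have gram (Y : 'M[R]_(n * d, d)) : ls_feasible Y -> frob (Y *m w) (Y *m w) = n%:R * frob w w.
  by move=> fY; rewrite frob_mull mulmxA ls_feasible_gram // mul_scalar_mx frobZr.
rewrite mulmxBl !frob_lin (gram _ fX) (gram _ (@ls_feasible_Z R n d)).
rewrite (frobC (Z *m w)) -mulmxA [frob (Z^T *m _) _]frob_mull trmxK; lra.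
Qed.

(** For P = Z^T X the forms satisfy 0 <= P <= n I, the upper bound by [form_deficit]; hence P^2 <= n
    P, and the trace is taken. *)
Lemma frob_correlation_le : (0 < n)%N ->
  frob (Z^T *m X) (Z^T *m X) <= n%:R * \tr (Z^T *m X).
Proof.
move=> n0; have n0R : 0 < n%:R :> R by rewrite ltr0n.
set P := Z^T *m X; case/psdP: pP; rewrite -/P => sP posP.
have leP (w : 'cV[R]_d) : frob (P *m w) w <= n%:R * frob w w.
  by rewrite -subr_ge0 form_deficit divr_ge0 // frob_ge0.
have step (v : 'cV[R]_d) : frob (P *m v) (P *m v) <= n%:R * frob (P *m v) v.
  (* Positivity of the form of P at v - n^-1 P v. *)
  have := posP (v - n%:R^-1 *: (P *m v)); have := leP (P *m v).
  rewrite mulmxBr -scalemxAr !frob_lin (frob_sym (P *m v) v sP).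
  set a := frob (P *m v) (P *m v); set b := frob _ v; set c := frob _ _ => h1 h2.
  have {}h2 : 0 <= n%:R ^+ 2 * (b - n%:R^-1 * a - (n%:R^-1 * a - n%:R^-1 * (n%:R^-1 * c))).
    by rewrite mulr_ge0 ?sqr_ge0 //; lra.
  have e : n%:R ^+ 2 * (b - n%:R^-1 * a - (n%:R^-1 * a - n%:R^-1 * (n%:R^-1 * c)))
     = n%:R ^+ 2 * b - 2 * n%:R * a + c by field; rewrite gt_eqF.
  by rewrite -(ler_pM2l n0R); lra.
rewrite frob_col /mxtrace mulr_sumr; apply: ler_sum => j _.
by have := step (delta_mx j 0); rewrite -colE frob_delta mxE.
Qed.

Lemma dist_sqr : dist ^+ 2 = 2 * (n * d)%:R - 2 * \tr (Z^T *m X).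
Proof.
rewrite nrm_sqr !frob_lin (frobC Z X) (ls_feasible_frob fX) (ls_feasible_frob (@ls_feasible_Z R n d)).
by rewrite [frob X Z]/frob [\tr (X *m _)]mxtrace_mulC; ring.
Qed.

Lemma sum_sqr : nrm (X + Z) ^+ 2 + dist ^+ 2 = 4 * (n * d)%:R.
Proof.
rewrite !nrm_sqr !frob_lin (frobC Z X) (ls_feasible_frob fX) (ls_feasible_frob (@ls_feasible_Z R n d)).
by ring.
Qed.

(** Comparison with Z gives n^2 d - |Z^T X|^2 <= <Delta (X - Z), X + Z>, and the left side is at
    least n |X - Z|^2 / 2 by [frob_correlation_le] and [dist_sqr]. The factor |X + Z| is kept so
    that [sum_sqr] can later make the bound strict. *)
Lemma dist_bound : (0 < n)%N ->
  n%:R * dist ^+ 2 <= 2 * (opnorm Delta * dist * nrm (X + Z)).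
Proof.
move=> n0; have := frob_correlation_le n0.
have := optX (@ls_feasible_Z R n d).
have objE (Y : 'M[R]_(n * d, d)) : frob (A *m Y) Y = frob (Z^T *m Y) (Z^T *m Y) + frob (Delta *m Y) Y.
  by rewrite mulmxDl frobDl -mulmxA frob_mull.
rewrite !objE (ls_feasible_gram (@ls_feasible_Z R n d)).
have -> : frob (n%:R%:M : 'M[R]_d) n%:R%:M = n%:R * (n * d)%:R.
  by rewrite /frob tr_scalar_mx -scalar_mxM mxtrace_scalar -[LHS]mulr_natr natrM mulrA.
have key : frob (Delta *m X) X - frob (Delta *m Z) Z <=
    opnorm Delta * dist * nrm (X + Z).
  have -> : frob (Delta *m X) X - frob (Delta *m Z) Z =
      frob (Delta *m (X - Z)) (X + Z).
    have e : frob (Delta *m X) Z = frob (Delta *m Z) X.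
      by rewrite frob_mull hsym frobC.
    by rewrite mulmxBr !frob_lin e; ring.
  apply: le_trans (frob_le_nrm _ _) _; apply: ler_wpM2r (nrm_opnorm _ _).
  exact: nrm_ge0.
by rewrite dist_sqr => h1 h2; lra.
Qed.

Section LowerBound.
(** A common bound on the norms of Delta_i^T X, left abstract because the case Delta = 0 uses
    another value. *)
Variable K : R.
Hypothesis hK : forall i (w : 'cV[R]_d), nrm (brow Delta i *m X *m w) <= K * nrm w.

(** Here L_i v = Z^T X w + Delta_i^T X w with w = X_i^T v of the same norm as v. The form of Z^T X
    is controlled at w, not between w and v, so |L_i v| is bounded below first and [psd_form_lower]
    returns to the form. *)
Lemma multiplier_lower i (v : 'cV[R]_d) :
  (n%:R - dist ^+ 2 / 2 - K) * frob v v <= frob (multiplier i *m v) v.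
Proof.
have pM : psd (multiplier i).
  case/psdP: (multiplier_psd i) => _ pM.
  apply/psdP; split=> [|w]; first exact: multiplier_sym.
  rewrite -[multiplier i](subrK 1%:M) mulmxDl mul1mx frobDl.
  by rewrite addr_ge0 ?pM ?frob_ge0.
apply: (psd_form_lower pM) => {}v.
set w := (rblk X i)^T *m v.
have nw : nrm w = nrm v by rewrite /nrm frob_mull trmxK mulmxA X_blkr mul1mx.
have -> : multiplier i *m v = Z^T *m X *m w + brow Delta i *m X *m w.
  rewrite /multiplier /A browE !mulmxDr !mulmxDl !mulmxA blkinj_Z mul1mx.
  by [].
have [v0|v0] := eqVneq (nrm v) 0; first by rewrite v0 mulr0 nrm_ge0.
have vpos : 0 < nrm v by rewrite lt_def v0 nrm_ge0.
set p := Z^T *m X *m w; set q := brow Delta i *m X *m w.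
have h1 : nrm p <= nrm (p + q) + nrm q.
  by rewrite -{1}[p](addrK q) -(nrmN q); exact: nrmD.
have h2 : (n%:R - dist ^+ 2 / 2) * nrm v <= nrm p.
  rewrite -(ler_pM2r vpos) -mulrA -expr2 -nw; apply: le_trans (frob_le_nrm _ _).
  have := form_deficit w; rewrite -/p.
  have : frob ((X - Z) *m w) ((X - Z) *m w) <= dist ^+ 2 * nrm w ^+ 2.
    rewrite -nrm_sqr -exprMn lerXn2r ?nnegrE ?nrm_ge0 ?mulr_ge0 ?nrm_ge0 //.
    exact: nrm_mulmx.
  by rewrite -[frob w w]nrm_sqr; lra.
by have := hK i w; rewrite nw -/q; lra.
Qed.

Definition certificate : 'M[R]_(n * d) :=
  \sum_i E i *m (multiplier i *m (E i)^T) - A.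

Lemma certificate_sym : certificate^T = certificate.
Proof.
rewrite /certificate linearB /= A_sym linear_sum /=; congr (_ - _).
apply: eq_bigr => i _; rewrite trmx_mul [(multiplier i *m _)^T]trmx_mul trmxK.
by rewrite multiplier_sym mulmxA.
Qed.

(** Complementary slackness: X_j^T X_j = I turns L_j X_j into the j-th block of A X. *)
Lemma certificate_mulX : certificate *m X = 0.
Proof.
apply: blkinj_ext => j; rewrite mulmx0 mulmxA mulmxBr blkinj_sum mulmxBl.
rewrite -(mulmxA (multiplier j)) -rblkE /multiplier -(mulmxA _ (_)^T) X_blkl mulmx1.
by rewrite subrr.
Qed.

(** Duality: diag(L_i) pairs only with the diagonal blocks of Y, which are fixed, so maximizing <A,
    Y> amounts to minimizing <S, Y>. *)
Lemma frob_certificate Y : (forall i, blk Y i i = 1%:M) ->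
  frob A Y = \sum_i \tr (multiplier i) - frob certificate Y.
Proof.
move=> Y1; rewrite [frob certificate Y]frobDl frobNl frob_suml opprD opprK addrA.
rewrite -[LHS]add0r; congr (_ + _); apply/esym/eqP; rewrite subr_eq0; apply/eqP.
apply: eq_bigr => i _; rewrite frob_mull frob_mulr trmxK -blkE Y1.
by rewrite /frob trmx1 mulmx1.
Qed.

(** The factor 3/2 is 1/2 from the multipliers plus 1 from Z Z^T: since X^T u = 0, Z^T u = -(X -
    Z)^T u has norm at most |X - Z| |u|. *)
Lemma certificate_lower_orth (u : 'cV[R]_(n * d)) : X^T *m u = 0 ->
  (n%:R - 3 / 2 * dist ^+ 2 - K - opnorm Delta) * frob u u
    <= frob (certificate *m u) u.
Proof.
move=> Xu; rewrite mulmxBl frobDl frobNl mulmx_suml frob_suml.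
have h1 : (n%:R - dist ^+ 2 / 2 - K) * frob u u <=
    \sum_i frob (E i *m (multiplier i *m (E i)^T) *m u) u.
  rewrite [frob u u]frob_blocks mulr_sumr; apply: ler_sum => i _.
  by rewrite -(mulmxA (E i)) -(mulmxA (multiplier i)) [leRHS]frob_mull multiplier_lower.
have -> : frob (A *m u) u = frob (Z^T *m u) (Z^T *m u) + frob (Delta *m u) u.
  by rewrite mulmxDl frobDl -mulmxA frob_mull.
have h2 : frob (Z^T *m u) (Z^T *m u) <= dist ^+ 2 * frob u u.
  have -> : Z^T *m u = - ((X - Z)^T *m u).
    by rewrite linearB /= mulmxBl Xu sub0r opprK.
  rewrite frobNl frobNr opprK -!nrm_sqr -exprMn.
  rewrite lerXn2r ?nnegrE ?nrm_ge0 ?mulr_ge0 ?nrm_ge0 //.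
  by apply: le_trans (nrm_mulmx _ _) _; rewrite nrm_tr.
have h3 : frob (Delta *m u) u <= opnorm Delta * frob u u.
  rewrite -[frob u u]nrm_sqr expr2 mulrA; apply: le_trans (frob_le_nrm _ _) _.
  by apply: ler_wpM2r (nrm_opnorm _ _); exact: nrm_ge0.
by lra.
Qed.

Let proj : 'M[R]_(n * d) := n%:R^-1 *: (X *m X^T).

(** As X^T X = n I, [proj] is the orthogonal projector onto the columns of X. S is symmetric and
    kills these columns, so its form only sees v - [proj] v. *)
Lemma certificate_lower (v : 'cV[R]_(n * d)) : (0 < n)%N ->
  (n%:R - 3 / 2 * dist ^+ 2 - K - opnorm Delta) *
    frob (v - proj *m v) (v - proj *m v) <= frob (certificate *m v) v.
Proof.
move=> n0; have n0R : n%:R != 0 :> R by rewrite pnatr_eq0 -lt0n.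
set u := v - proj *m v.
have Xu : X^T *m u = 0.
  rewrite mulmxBr mulmxA -scalemxAr mulmxA ls_feasible_gram // mul_scalar_mx.
  by rewrite scalerA mulVf // scale1r subrr.
have vE : v = u + X *m (n%:R^-1 *: (X^T *m v)).
  by rewrite -scalemxAr mulmxA scalemxAl subrK.
have -> : frob (certificate *m v) v = frob (certificate *m u) u.
  have Su : certificate *m v = certificate *m u.
    by rewrite {1}vE mulmxDr mulmxA certificate_mulX mul0mx addr0.
  rewrite Su [X in frob _ X]vE frobDr [X in _ + X]frob_mull certificate_sym mulmxA.
  by rewrite certificate_mulX mul0mx [X in _ + X]frobC frob0l addr0.
exact: certificate_lower_orth.
Qed.

Hypothesis n_gt0 : (0 < n)%N.
Hypothesis gap : 0 < n%:R - 3 / 2 * dist ^+ 2 - K - opnorm Delta.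

Lemma sdp_maximizer_gram : sdp_maximizer A (X *m X^T).
Proof.
have fXX := sdp_feasible_gram fX; split => // Y [Y1 pY].
rewrite (frob_certificate Y1) (frob_certificate fXX.1) lerD2l lerN2.
rewrite -(frob_mulr certificate) certificate_mulX frob0l.
have [s ->] := psd_sum_outer pY; rewrite frob_sum_outer; apply: sumr_ge0 => v _.
by apply: le_trans (certificate_lower v n_gt0); rewrite mulr_ge0 ?frob_ge0 // ltW.
Qed.

Lemma sdp_maximizer_unique Y : sdp_maximizer A Y -> Y = X *m X^T.
Proof.
move=> [[Y1 pY] maxY].
have fXX := sdp_feasible_gram fX.
have := maxY _ fXX.
rewrite (frob_certificate Y1) (frob_certificate fXX.1) lerD2l lerN2.
rewrite -(frob_mulr certificate) certificate_mulX frob0l.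
have [s YE] := psd_sum_outer pY; rewrite {1}YE frob_sum_outer => S0.
have form_ge0 (v : 'cV[R]_(n * d)) : 0 <= frob (certificate *m v) v :> R.
  by apply: le_trans (certificate_lower v n_gt0); rewrite mulr_ge0 ?frob_ge0 // ltW.
(* The nonnegative terms of <S, Y> have sum at most 0, so each vanishes; the positive gap then puts
   each [v] in the column span of [X]. *)
have projv v : v \in s -> proj *m v = v.
  move=> vs; apply/esym/eqP; rewrite -subr_eq0; apply/eqP/frob_eq0/eqP.
  rewrite eq_le frob_ge0 andbT -(pmulr_rle0 _ gap).
  apply: le_trans (certificate_lower v n_gt0) (le_trans _ S0).
  rewrite (big_rem v) //= lerDl; exact: sumr_ge0.
have projY : proj *m Y = Y.
  rewrite YE mulmx_sumr; apply: eq_big_seq => v vs.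
  by rewrite mulmxA projv.
have Yproj : Y *m proj = Y.
  have sY : Y^T = Y by case: pY.
  have sproj : proj^T = proj by rewrite /proj linearZ /= trmx_mul trmxK.
  by rewrite -[LHS]trmxK trmx_mul sY sproj projY sY.
pose W := (n%:R^-1 * n%:R^-1) *: (X^T *m Y *m X).
have YW : Y = X *m W *m X^T.
  rewrite -{1}Yproj -{1}projY /proj /W -!scalemxAl -!scalemxAr -!scalemxAl scalerA.
  by rewrite !mulmxA.
(* Now Y = X W X^T, and a single diagonal block, X_i W X_i^T = I with X_i orthogonal, determines
   W. *)
pose i := Ordinal n_gt0.
have RWR : rblk X i *m W *m (rblk X i)^T = 1%:M.
  by rewrite -(Y1 i) blkE [in RHS]YW rblkE trmx_mul trmxK !mulmxA.
have W1 : W = 1%:M.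
  have := congr1 (fun M => (rblk X i)^T *m M *m rblk X i) RWR.
  by rewrite mulmx1 X_blkl !mulmxA X_blkl mul1mx -mulmxA X_blkl mulmx1.
by rewrite {1}YW W1 mulmx1.
Qed.

End LowerBound.
End Certificate.

(* Strictness for D > 0 comes from f < 2 N s unless e = 0; it is what allows a
   non-strict inequality in the hypothesis of the theorem. *)
Lemma distance_bound (R : realType) (e f D N s : R) :
  0 <= e -> 0 <= f -> 0 <= D -> 0 < N -> 0 < s ->
  f ^+ 2 + e ^+ 2 = 4 * (N * s) ^+ 2 -> N * e ^+ 2 <= 2 * (D * e * f) ->
  (D = 0 -> e = 0) /\ (0 < D -> e < 4 * s * D).
Proof.
move=> e0 f0 D0 N0 s0 fe h; have Ns0 : 0 < N * s by rewrite mulr_gt0.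
split=> [DE|Dpos].
  move: h; rewrite DE !mul0r mulr0 (pmulr_rle0 _ N0) => h.
  by apply/eqP; rewrite -sqrf_eq0 eq_le h sqr_ge0.
have [->|eN0] := eqVneq e 0; first by have := mulr_gt0 s0 Dpos; lra.
have epos : 0 < e by rewrite lt_def eN0 e0.
have fl : f < 2 * (N * s).
  rewrite -(@ltr_pXn2r _ 2) ?nnegrE //; last by lra.
  have : 0 < e ^+ 2 by rewrite exprn_gt0.
  by rewrite exprMn; lra.
have h1 : N * e <= 2 * (D * f).
  by rewrite -(ler_pM2r epos); move: h; rewrite expr2; lra.
have h2 : D * f < D * (2 * (N * s)) by rewrite ltr_pM2l.
by rewrite -(ltr_pM2l N0); lra.
Qed.

(** X^T (X X^T) X = c^2 I has rank p, and multiplication cannot raise the rank. *)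
Lemma mxrank_gram (R : realType) m p (X : 'M[R]_(m, p)) (c : R) :
  c != 0 -> X^T *m X = c%:M -> \rank (X *m X^T) = p.
Proof.
move=> c0 XX; apply/eqP; rewrite eqn_leq; apply/andP; split.
  exact: leq_trans (mxrankM_maxl _ _) (rank_leq_col _).
have {1}-> : p = \rank (X^T *m (X *m X^T) *m X).
  rewrite mulmxA -mulmxA XX -scalar_mxM -scalemx1 mxrank_scale_nz ?mxrank1 //.
  by rewrite mulf_neq0.
exact: leq_trans (mxrankM_maxl _ _) (mxrankM_maxr _ _).
Qed.

(** * From the hypothesis to the spectral gap of the certificate *)

Theorem theorem1 (R : realType) (n d : nat) (hn : (0 < n)%N) (hd : (0 < d)%N)
  (Delta : 'M[R]_(n * d))
  (hsym : Delta^T = Delta)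
  (hdiag : forall i : 'I_n, blk Delta i i = 0)
  (delta := 4 : R)
  (hcond : n%:R >=
     3 * delta ^+ 2 * d%:R * opnorm Delta ^+ 2 / (2 * n%:R)
     + delta * Num.sqrt (d%:R / n%:R) * opnorm Delta
         * \big[Num.max/0]_(i < n) opnorm (brow Delta i)^T
     + \big[Num.max/0]_(i < n) opnorm (brow Delta i *m Zmat R n d)
     + opnorm Delta) :
  let A := Zmat R n d *m (Zmat R n d)^T + Delta in
  exists Xh : 'M[R]_(n * d),
    [/\ sdp_maximizer A Xh,
        (forall X, sdp_maximizer A X -> X = Xh),
        \rank Xh = d &
        exists Rh : 'M[R]_(n * d, d),
          [/\ ls_feasible Rh, Xh = Rh *m Rh^T & ls_maximizer A Rh]].
Proof.
set Z := Zmat R n d; move=> A.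
have n0 : 0 < n%:R :> R by rewrite ltr0n.
have d0 : 0 < d%:R :> R by rewrite ltr0n.
have [X0 [fX0 maxX0]] := exists_ls_maximizer A.
have [Q [Q1 Q2] pP] := exists_polar (Z^T *m X0).
(* The rotation changes neither the Gram matrix nor the objective, and makes Z^T X positive
   semidefinite. *)
pose X := X0 *m Q.
have fX : ls_feasible X.
  move=> i; rewrite rblkE mulmxA -rblkE; exact: orthogonal_mul (fX0 i) _.
have XX : X *m X^T = X0 *m X0^T by rewrite trmx_mul mulmxA -(mulmxA X0) Q2 mulmx1.
have obj : frob (A *m X) X = ls_obj A X0.
  by rewrite ls_objE !frob_mulr XX.
have optX Y : ls_feasible Y -> frob (A *m Y) Y <= frob (A *m X) X.
  by move=> fY; rewrite obj -ls_objE; exact: maxX0.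
have pPX : psd (Z^T *m X) by rewrite mulmxA.
set s := Num.sqrt (d%:R / n%:R) in hcond.
have s0 : 0 < s by rewrite sqrtr_gt0 divr_gt0.
have s2 : s ^+ 2 = d%:R / n%:R by rewrite sqr_sqrtr // divr_ge0 // ltW.
set D := opnorm Delta in hcond; have D0 : 0 <= D := opnorm_ge0 _.
set e := nrm (X - Z).
have e0 : 0 <= e := nrm_ge0 _.
have [eD0 eDpos] : (D = 0 -> e = 0) /\ (0 < D -> e < 4 * s * D).
  (* With s = sqrt(d/n) one has (n s)^2 = n d, which matches [sum_sqr]. *)
  apply: (distance_bound e0 (nrm_ge0 (X + Z)) D0 n0 s0).
    rewrite (sum_sqr fX) natrM exprMn s2; field; exact: lt0r_neq0.
  exact: dist_bound hsym fX optX pPX hn.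
suff [K hK gap] : exists2 K, forall i (w : 'cV[R]_d),
    nrm (brow Delta i *m X *m w) <= K * nrm w &
    0 < n%:R - 3 / 2 * e ^+ 2 - K - D.
  exists (X *m X^T); split.
  - exact: (sdp_maximizer_gram hsym hdiag fX optX hK hn gap).
  - exact: (sdp_maximizer_unique hsym hdiag fX optX hK hn gap).
  - exact: mxrank_gram (lt0r_neq0 n0) (ls_feasible_gram fX).
  exists X; split=> //; split=> // Y fY; rewrite !ls_objE; exact: optX.
set B1 := \big[Num.max/0]_(i < n) opnorm (brow Delta i)^T in hcond.
set B2 := \big[Num.max/0]_(i < n) opnorm (brow Delta i *m Z) in hcond.
have B1le i : opnorm (brow Delta i)^T <= B1 by exact: le_bigmax.
have B2le i : opnorm (brow Delta i *m Z) <= B2 by exact: le_bigmax.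
(* For D = 0 no strict distance bound is available, but then e = 0 and [K = 0] leave the gap n >
   0. *)
have [/eqP D00|DN0] := boolP (D == 0).
  exists 0; last by rewrite (eD0 D00) D00 expr0n /=; lra.
  have Delta0 : Delta = 0.
    apply: frob_eq0; rewrite -nrm_sqr; apply/eqP; rewrite sqrf_eq0 eq_le nrm_ge0 andbT.
    by have := nrm_opnorm Delta 1%:M; rewrite mulmx1 -/D D00 mul0r.
  move=> i w; rewrite browE Delta0 mulmx0 !mul0mx mul0r /nrm frob0l sqrtr0 //.
have Dpos : 0 < D by rewrite lt_def DN0 D0.
have eT := eDpos Dpos.
(* The splitting X = Z + (X - Z) bounds Delta_i^T X by these two terms. *)
exists (B2 + B1 * e) => [i w|].
  have -> : brow Delta i *m X *m w =
      brow Delta i *m Z *m w + brow Delta i *m ((X - Z) *m w).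
    by rewrite -(mulmxA _ X) -(mulmxA _ Z) -mulmxDr -mulmxDl [Z + _]addrC subrK.
  apply: le_trans (nrmD _ _) _; rewrite mulrDl; apply: lerD.
    apply: le_trans (nrm_opnorm _ _) _; by rewrite ler_wpM2r ?nrm_ge0 ?B2le.
  apply: le_trans (nrm_opnorm_tr _ _) _; rewrite -mulrA.
  by apply: ler_pM; rewrite ?opnorm_ge0 ?nrm_ge0 // nrm_mulmx.
have B10 : 0 <= B1 by apply: bigmax_ge_id.
(* The first two terms of the hypothesis are 3/2 e^2 and B1 e with e replaced by its bound 4 s D.
   The first comparison is strict, hence so is the gap. *)
have hc2 : 3 * delta ^+ 2 * d%:R * D ^+ 2 / (2 * n%:R) = 3 / 2 * (4 * s * D) ^+ 2.
  by rewrite !exprMn s2 /delta; field; exact: lt0r_neq0.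
have e2 : e ^+ 2 < (4 * s * D) ^+ 2 by rewrite ltr_pXn2r ?nnegrE // ltW // (le_lt_trans e0 eT).
have be : B1 * e <= B1 * (4 * s * D) by rewrite ler_wpM2l // ltW.
by move: hcond; rewrite hc2 /delta; lra.
Qed.
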